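(* For every real $q$ with $1<q<\infty$ there is a constant $C_q>0$, depending only on $q$, such that the following holds. Let $\mathbf p=(p_1,\ldots,p_r)$ be an $r$-tuple of distinct primes, and let $f(t)=\sum_{a\in A}\hat f(a)e(at)$ be a trigonometric polynomial whose Fourier coefficients are supported in a set $A$ of the form \[A=\bigcup_{\mathbf v\in V}\mathbf p^{\mathbf v}B_{\mathbf v},\] where $V\subseteq\mathbb{N}_0^r$ and each $B_{\mathbf v}$ is a set of integers coprime to $p_1\cdots p_r$. Define \[f_{\mathbf v}(t)=\sum_{b\in B_{\mathbf v}}\hat f(\mathbf p^{\mathbf v}b)\,e(\mathbf p^{\mathbf v}bt).\] Then \[\|f\|_{L^q}\ \le\ C_q^r\left\|\left(\sum_{\mathbf v\in V}|f_{\mathbf v}|^2\right)^{1/2}\right\|_{L^q}.\]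
   Context: $e(x)=e^{2\pi i x}$. A trigonometric polynomial is a function $f:\mathbb{R}/\mathbb{Z}\to\mathbb{C}$ of the form $f(t)=\sum_{n\in\mathbb{Z}}\hat f(n)e(nt)$ with finitely many nonzero coefficients $\hat f(n)\in\mathbb{C}$. $\|f\|_{L^q}=\left(\int_0^1|f(t)|^q\,dt\right)^{1/q}$. For $\mathbf v=(v_1,\ldots,v_r)$, $\mathbf p^{\mathbf v}=p_1^{v_1}\cdots p_r^{v_r}$. $\mathbb{N}_0$ denotes the non-negative integers. *)

(* Defs.v *)
From HB Require Import structures.
From mathcomp Require Import all_boot all_order all_algebra.
From mathcomp Require Import complex.
From mathcomp Require Import all_classical all_reals all_analysis.

Set Implicit Arguments.
Unset Strict Implicit.
Unset Printing Implicit Defensive.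

Import Order.TTheory GRing.Theory Num.Theory.
Import numFieldNormedType.Exports.

Local Open Scope classical_set_scope.
Local Open Scope ring_scope.
Local Open Scope complex_scope.

(* The modulus of a complex number as an element of [R]; the norm [`|z|] of
   [z : R[i]] is itself an element of [R[i]]. *)
Definition cmod (R : realType) (z : R[i]) : R := ComplexField.Normc.normc z.

(* e(x) = exp(2 pi i x) *)
Definition e (R : realType) (x : R) : R[i] :=
  cos (2 * pi * x) +i* sin (2 * pi * x).

(* Functions on R/Z are represented as functions on R: a trigonometric
   polynomial is 1-periodic by its defining formula. The sum [\sum_(n \in _)]
   ranges over the finitely many indices whose term is nonzero. *)
Definition trig_poly (R : realType) (f : R -> R[i]) (fhat : int -> R[i]) : Prop :=
  finite_set [set n | fhat n != 0] /\
  forall t, f t = \sum_(n \in [set: int]) fhat n * e (n%:~R * t).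

(* The L^q norm on R/Z, computed on the fundamental domain [0, 1]. *)
Definition Lqnorm (R : realType) (q : R) (f : R -> R[i]) : \bar R :=
  ((\int[lebesgue_measure]_(t in `[0%R, 1%R]) (cmod (f t) `^ q)%:E) `^ q^-1)%E.

Definition mpow (r : nat) (p v : r.-tuple nat) : nat :=
  (\prod_(i < r) tnth p i ^ tnth v i)%N.

(* f_v. When [fhat] is finitely supported and the [p_i] are positive, at most
   finitely many terms of this sum are nonzero, even if [B v] is infinite. *)
Definition piece (R : realType) (r : nat) (p : r.-tuple nat)
    (B : r.-tuple nat -> set int) (fhat : int -> R[i]) (v : r.-tuple nat)
    (t : R) : R[i] :=
  \sum_(b \in B v)
     fhat ((mpow p v)%:Z * b) * e (((mpow p v)%:Z * b)%:~R * t).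

Definition square_function (R : realType) (r : nat) (p : r.-tuple nat)
    (V : set (r.-tuple nat)) (B : r.-tuple nat -> set int)
    (fhat : int -> R[i]) (t : R) : R[i] :=
  (Num.sqrt (\sum_(v \in V) cmod (piece p B fhat v t) ^+ 2))%:C.

(* Main.v *)
Require Import Defs.
From HB Require Import structures.
From mathcomp Require Import all_boot all_order all_algebra.
From mathcomp Require Import complex.
From mathcomp Require Import all_classical all_reals all_analysis.
From mathcomp Require Import measurable_realfun.
From mathcomp Require Import ring lra.

Set Implicit Arguments.
Unset Strict Implicit.
Unset Printing Implicit Defensive.

Import Order.TTheory GRing.Theory Num.Theory.
Import numFieldNormedType.Exports.

Local Open Scope classical_set_scope.
Local Open Scope ring_scope.

(** Fix one prime [l].  Averaging a trigonometric polynomial over the translates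
by multiples of [1 / l ^ k] keeps exactly the frequencies divisible by [l ^ k],
so these averages form a reverse martingale, whose increments are the parts
[F k] of the polynomial with frequencies of [l]-adic valuation exactly [k].
The case of one prime is therefore the square function inequality
[ ||x||_q <= C ||s||_q ] for a martingale [x] with values in a Hilbert space,
where [s ^ 2] is the sum of the squared norms of the increments; [x] starts from
zero because all frequencies have finite valuation.  It is proved by the Bellman
function method: one looks for a function [Phi] of [|x|^2] and [s^2] that
dominates [|x|^q - C s^q], vanishes at the origin, and increases along an
increment [d] by at most a term linear in [d] (lemma [bellman_exists]).  The
linear term averages to zero, so the mean of [Phi] never increases and stays nonpositive
([reverse_martingale_bound]).

Since the inequality holds for vector-valued martingales, it applies to the
family of all pieces already cut out by the other primes, and every prime costs
one factor [C] ([square_function_one_prime], [square_function_many_primes]).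

Everything up to that point happens at a fixed [t], for averages over the
finitely many points [t + j / N], where [N] is a multiple of a high power of
each prime.  Since translations preserve the integral over a period,
integrating these averages gives the inequality between the norms
([ge0_le_integral_avg]). *)

(** * Inequalities for real powers and Bellman functions *)

Section Bellman.
Context {R : realType}.
Implicit Types a b c p X Y D : R.

(** Young's inequality with the conjugate exponents [p] and [p / (p - 1)],
applied to [b] and [a `^ (p - 1)]. *)
Lemma powR_ge_tangent p a b : 1 <= p -> 0 <= a -> 0 <= b ->
  a `^ p + p * a `^ (p - 1) * (b - a) <= b `^ p.
Proof.
move=> p1 a0 b0; have p0 : 0 < p by lra.
have aE : a * a `^ (p - 1) = a `^ p by rewrite mulr_powRB1.
have [->|pN1] := eqVneq p 1.
  by rewrite subrr powRr0 !powRr1//; lra.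
have p10 : 0 < p - 1 by rewrite subr_gt0 lt_neqAle eq_sym pN1.
have := @conjugate_powR R b (a `^ (p - 1)) p (p / (p - 1)) b0 (powR_ge0 _ _) p0.
rewrite divr_gt0// => /(_ isT); rewrite -powRrM.
have -> : (p - 1) * (p / (p - 1)) = p by field; lra.
have -> : p^-1 + (p / (p - 1))^-1 = 1 by field; lra.
move=> /(_ erefl) /(ler_wpM2l (ltW p0)).
have -> : p * (b `^ p / p + a `^ p / (p / (p - 1))) = b `^ p + (p - 1) * a `^ p.
  by field; lra.
rewrite -aE; lra.
Qed.

(** The convex case for the exponent [p^-1], at the points [a `^ p] and
[b `^ p]. *)
Lemma powR_le_tangent p a b : 0 < p <= 1 -> 0 < a -> 0 <= b ->
  b `^ p <= a `^ p + p * a `^ (p - 1) * (b - a).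
Proof.
move=> /andP[p0 p1] a0 b0.
have ip1 : 1 <= p^-1 by rewrite invf_ge1.
have := powR_ge_tangent ip1 (powR_ge0 a p) (powR_ge0 b p).
rewrite -!powRrM.
have -> : p * (p^-1 - 1) = 1 - p by field; lra.
rewrite divff ?gt_eqF// !powRr1 ?(ltW a0)//.
move=> /(ler_wpM2l (mulr_ge0 (ltW p0) (powR_ge0 a (p - 1)))).
have E : a `^ (p - 1) * a `^ (1 - p) = 1.
  rewrite -powRD ?(gt_eqF a0) ?implybT//.
  have -> : p - 1 + (1 - p) = 0 by lra.
  by rewrite powRr0.
rewrite mulrDr.
have -> : p * a `^ (p - 1) * (p^-1 * a `^ (1 - p) * (b `^ p - a `^ p)) =
  (a `^ (p - 1) * a `^ (1 - p)) * (b `^ p - a `^ p) by field; lra.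
rewrite E; lra.
Qed.

Lemma powR_le p a b : 0 <= p -> 0 <= a -> a <= b -> a `^ p <= b `^ p.
Proof.
by move=> p0 a0 ab; apply: ge0_ler_powR; rewrite ?nnegrE// (le_trans a0).
Qed.

Lemma powR_le_anti p a b : p <= 0 -> 0 < a -> a <= b -> b `^ p <= a `^ p.
Proof.
move=> p0 a0 ab; rewrite -[p]opprK powRN (powRN a).
rewrite lef_pV2 ?posrE ?powR_gt0//; last exact: lt_le_trans ab.
by apply: powR_le => //; [lra|exact: ltW].
Qed.

Lemma sqr_le_bounds a b : 0 <= b -> a ^+ 2 <= b ^+ 2 -> - b <= a <= b.
Proof. by move=> b0 ab; apply/andP; split; rewrite leNgt; apply/negP; nra. Qed.

(** A martingale with values in a Hilbert space enters only through
[X = |x|^2], where [x] is its current value, and [Y = s^2], the sum of the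
squared norms of its past increments.  An increment [d] moves [(X, Y)] to
[(X + 2 * c + D, Y + D)], where [D = |d|^2] and [c = <x, d>] are tied only by
the Cauchy-Schwarz inequality.  The term [Gam X Y * c] is linear in [d], hence
has mean zero.  The exponent [p] is half of the Lebesgue exponent. *)
Definition bellman (p C : R) (Phi Gam : R -> R -> R) : Prop :=
  [/\ Phi 0 0 <= 0,
      forall X Y c D, 0 <= X -> 0 <= Y -> 0 <= D -> c ^+ 2 <= X * D ->
        Phi (X + 2 * c + D) (Y + D) <= Phi X Y + Gam X Y * c &
      forall X Y, 0 <= X -> 0 <= Y -> X `^ p <= Phi X Y + C * Y `^ p].

(** Here [Phi = (X + Y)^p - 28 Y^p].  A step with [D < X + Y] is controlled by
concavity of the power: the first term grows by at most the linear term plus a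
multiple of [D (X + Y)^(p - 1)], and [Y^p] grows by at least a multiple of the
same quantity because [p <= 1].  In a step with [X + Y <= D] all terms are at most of order [D^p], including the linear one
because [p >= 1/2], while [Y^p] grows by at least a multiple of [D^p]. *)
Lemma bellman_le1 p : 2^-1 <= p <= 1 -> exists2 C, 0 < C &
  exists Phi Gam, bellman p C Phi Gam.
Proof.
move=> /andP[p2 p1]; have p0 : 0 < p by lra.
exists 28 => //.
exists (fun X Y => (X + Y) `^ p - 28 * Y `^ p).
exists (fun X Y => 2 * p * (X + Y) `^ (p - 1)); split.
- by rewrite addr0 powR0 ?gt_eqF// mulr0 subrr.
- move=> X Y c D X0 Y0 D0 cXD.
  set a := X + Y; have a0 : 0 <= a by rewrite addr_ge0.
  have caD : c ^+ 2 <= a * D by rewrite /a; nra.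
  have -> : X + 2 * c + D + (Y + D) = a + 2 * c + 2 * D by rewrite /a; lra.
  have b0 : 0 <= a + 2 * c + 2 * D.
    have : 0 <= X + 2 * c + D; last by rewrite /a; lra.
    have : (2 * c) ^+ 2 <= (X + D) ^+ 2 by have := sqr_ge0 (X - D); lra.
    by move=> /(sqr_le_bounds (addr_ge0 X0 D0))/andP[]; lra.
  suff : (a + 2 * c + 2 * D) `^ p + 28 * Y `^ p <=
    a `^ p + 2 * p * a `^ (p - 1) * c + 28 * (Y + D) `^ p by lra.
  have [Da|aD] := ltP D a.
    have agt0 : 0 < a by lra.
    have := powR_le_tangent (introT andP (conj p0 p1)) agt0 b0.
    have [->|DN0] := eqVneq D 0; first by rewrite !mulr0 !addr0; lra.
    have Dgt0 : 0 < D by rewrite lt_neqAle eq_sym DN0.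
    have := powR_le_tangent (introT andP (conj p0 p1)) (ltr_wpDl Y0 Dgt0) Y0.
    have : (2 * a) `^ (p - 1) <= (Y + D) `^ (p - 1).
      by apply: powR_le_anti; rewrite /a in Da *; lra.
    rewrite powRM//.
    have : 2^-1 <= 2 `^ (p - 1) :> R.
      by rewrite -powR_inv1// ler_powR//; lra.
    have := powR_ge0 a (p - 1).
    set A := a `^ (p - 1); set B := (Y + D) `^ (p - 1); set T := 2 `^ (p - 1).
    move=> A0 T2 TAB h1 h2.
    have AB : A / 2 <= B by nra.
    have pD : 0 <= p * D by apply: mulr_ge0; lra.
    have : p * D * (A / 2) <= p * D * B by exact: ler_wpM2l.
    have : 0 <= p * D * (A / 2) by apply: mulr_ge0; lra.
    lra.
  have [D00|DN0] := eqVneq D 0.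
    have a00 : a = 0 by lra.
    have c00 : c = 0 by rewrite D00 mulr0 in caD; nra.
    by rewrite c00 D00 a00 !mulr0 !addr0 powR0 ?gt_eqF//; lra.
  have Dgt0 : 0 < D by rewrite lt_neqAle eq_sym DN0.
  have Dp0 := powR_gt0 p Dgt0.
  (* [|c| <= D] because [c ^ 2 <= a * D] and [a <= D] *)
  have L : (a + 2 * c + 2 * D) `^ p <= 5 * D `^ p.
    have /(sqr_le_bounds D0)/andP[cD cD'] : c ^+ 2 <= D ^+ 2 by nra.
    apply: (@le_trans _ _ ((5 * D) `^ p)); first by apply: powR_le; lra.
    rewrite powRM// ler_pM2r//.
    by rewrite -{2}(powRr1 (_ : 0 <= 5 :> R))// ler_powR//; lra.
  have Rt : - D `^ p <= a `^ (p - 1) * c.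
    have [a00|aN0] := eqVneq a 0.
      have -> : c = 0 by rewrite a00 mul0r in caD; nra.
      by rewrite mulr0; lra.
    have agt0 : 0 < a by rewrite lt_neqAle eq_sym aN0.
    have bd : 0 <= a `^ 2^-1 * D `^ 2^-1 by rewrite mulr_ge0 ?powR_ge0.
    have : c ^+ 2 <= (a `^ 2^-1 * D `^ 2^-1) ^+ 2.
      by rewrite exprMn !powR12_sqrt// !sqr_sqrtr.
    move=> /(sqr_le_bounds bd)/andP[c1 _].
    have : a `^ (p - 1) * (a `^ 2^-1 * D `^ 2^-1) <= D `^ p.
      rewrite mulrA -powRD ?(gt_eqF agt0) ?implybT//.
      have -> : p = (p - 1 + 2^-1) + 2^-1 by field.
      rewrite (@powRD _ D) ?(gt_eqF Dgt0) ?implybT//.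
      rewrite ler_wpM2r ?powR_ge0//.
      have -> : p - 1 + 2^-1 + 2^-1 - 1 + 2^-1 = p - 1 + 2^-1 by field.
      by apply: powR_le => //; lra.
    by have := powR_ge0 a (p - 1); nra.
  have St : 4^-1 * D `^ p <= (Y + D) `^ p - Y `^ p.
    have YD : Y + D <= 2 * D by rewrite /a in aD; lra.
    have := powR_le_tangent (introT andP (conj p0 p1)) (ltr_wpDl Y0 Dgt0) Y0.
    have : (2 * D) `^ (p - 1) <= (Y + D) `^ (p - 1).
      by apply: powR_le_anti; lra.
    rewrite powRM//.
    have : 2^-1 <= 2 `^ (p - 1) :> R.
      by rewrite -powR_inv1// ler_powR//; lra.
    have E : D * D `^ (p - 1) = D `^ p by rewrite mulr_powRB1.
    have := powR_ge0 D (p - 1).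
    rewrite -E; set A := D `^ (p - 1); set B := (Y + D) `^ (p - 1); set T := 2 `^ (p - 1).
    move=> A0 T2 TAB h1.
    have AB : A / 2 <= B by nra.
    have : 4^-1 * (D * A) <= p * D * B.
      have : 0 <= D * (A / 2) by apply: mulr_ge0; lra.
      have : D * (A / 2) <= D * B by exact: ler_wpM2l.
      nra.
    lra.
  have := ler_wpM2l (ltW p0) Rt.
  have : p * D `^ p <= D `^ p by rewrite ler_piMl// ltW.
  have := powR_ge0 a p.
  lra.
- by move=> X Y X0 Y0; rewrite subrK; apply: powR_le => //; lra.
Qed.

(** The tangent at [1 + z] bounds [(1 + z)^p - 1] by [p z (1 + z)^(p - 1)], so
it is enough that [(1 + z)^(p - 1)] be Lipschitz at [z = 0]; tangents again
when [p - 1 >= 1], and comparison with [1 + z] when [p - 1 <= 1]. *)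
Lemma powR_le_quadratic p : 1 <= p -> exists2 K, 0 <= K &
  forall z, -1 <= z <= 1 -> (1 + z) `^ p <= 1 + p * z + K * z ^+ 2.
Proof.
move=> p1; pose K := 1 + (p - 1) * 2 `^ (p - 1).
have K0 : 0 <= K by rewrite addr_ge0// mulr_ge0 ?powR_ge0//; lra.
exists (p * K); first by rewrite mulr_ge0//; lra.
move=> z /andP[z1 z2].
have z10 : 0 <= 1 + z by lra.
have T := powR_ge_tangent p1 z10 ler01; rewrite powR1 in T.
suff : z * ((1 + z) `^ (p - 1) - 1) <= K * z ^+ 2.
  have p0 : 0 <= p by lra.
  move=> /(ler_wpM2l p0); lra.
have zz := sqr_ge0 z.
have PP : 0 <= (p - 1) * 2 `^ (p - 1) by rewrite mulr_ge0 ?powR_ge0//; lra.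
have [p2|p2] := leP 1 (p - 1).
  have [zp|zn] := leP 0 z.
    have := powR_ge_tangent p2 z10 ler01; rewrite powR1.
    have : (1 + z) `^ (p - 1 - 1) <= 2 `^ (p - 1).
      apply: (@le_trans _ _ (2 `^ (p - 1 - 1))); first by apply: powR_le; lra.
      by rewrite ler_powR//; lra.
    have p10 : 0 <= (p - 1) * z by apply: mulr_ge0; lra.
    move=> /(ler_wpM2l p10) h1 h2.
    have : (1 + z) `^ (p - 1) - 1 <= (p - 1) * z * 2 `^ (p - 1) by lra.
    move=> /(ler_wpM2l zp); rewrite /K; lra.
  have := powR_ge_tangent p2 ler01 z10; rewrite !powR1 => h.
  have h2 : (p - 1) <= (p - 1) * 2 `^ (p - 1).
    rewrite ler_peMr//; first lra.
    by rewrite -{1}(powRr0 2) ler_powR//; lra.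
  have nz : 0 <= - z by lra.
  have : - ((1 + z) `^ (p - 1) - 1) <= (p - 1) * - z by lra.
  move=> /(ler_wpM2l nz).
  have := ler_wpM2r zz h2.
  by rewrite /K; lra.
have [zp|zn] := leP 0 z.
  have : (1 + z) `^ (p - 1) <= 1 + z by apply: ler1_powR; lra.
  have := mulr_ge0 PP zz.
  rewrite /K; nra.
have : 1 + z <= (1 + z) `^ (p - 1).
  have [z0|z0] := eqVneq (1 + z) 0; first by rewrite z0 powR_ge0.
  by apply: ger1_powR; last lra; rewrite lt_neqAle eq_sym z0 z10 /=; lra.
have := mulr_ge0 PP zz.
rewrite /K; nra.
Qed.

Lemma powR_add_ge p Y D : 1 <= p -> 0 <= Y -> 0 <= D ->
  Y `^ p + D * (Y + D) `^ (p - 1) <= (Y + D) `^ p.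
Proof.
move=> p1 Y0 D0; have p0 : 0 < p by lra.
rewrite -(mulr_powRB1 Y0 p0) -(mulr_powRB1 (addr_ge0 Y0 D0) p0) mulrDl lerD2r.
by apply: ler_wpM2l => //; apply: powR_le; lra.
Qed.

(** Here [Phi] is twice [X^p - K1 X^mu Y^b - K2 Y^p], where [p = mu + b] with
[mu >= 1] and [0 < b <= 1].  In a step with [16 D < X], a Taylor expansion shows
that [X^p] grows by the linear term plus a multiple of [D X^(p - 1)].  If
[Y + D >= X] this is absorbed by the growth of [Y^p].  Otherwise it is absorbed
by that of [X^mu Y^b]: as [X^mu] is convex in [x], this product grows by at
least a linear term plus [X^mu] times the increment of [Y^b], which is of order
[D X^(b - 1)] as [b <= 1].  A step with [X <= 16 D] only involves terms of order
[D^p].  The factor 2 leaves room to absorb [K1 X^mu Y^b] into [X^p] and [Y^p]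
in the lower bound for [Phi]. *)
Lemma bellman_gt1 p : 1 < p -> exists2 C, 0 < C &
  exists Phi Gam, bellman p C Phi Gam.
Proof.
move=> p1; have p0 : 0 < p by lra.
have [mu [b [mu1 /andP[b0 b1] pE]]] :
    exists mu b : R, [/\ 1 <= mu, 0 < b <= 1 & p = mu + b].
  have [p2|p2] := leP p 2; first by exists 1, (p - 1); split => //; lra.
  by exists (p - 1), 1; split => //; lra.
have mu0 : 0 < mu by lra.
have [K K0 HK] := powR_le_quadratic (ltW p1).
pose C' := 9 * K + p.
have C'0 : 0 < C' by rewrite /C'; lra.
have h0 : 0 < (2^-1 : R) `^ mu by rewrite powR_gt0.
pose K1 := C' / (2^-1 `^ mu * b).
have K10 : 0 < K1 by rewrite divr_gt0// mulr_gt0.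
have K1E : K1 * (2^-1 `^ mu * b) = C' by rewrite divfK// gt_eqF// mulr_gt0.
pose K2 := C' + 25 `^ p + 8 * p * 16 `^ (p - 1).
have K20 : 0 < K2.
  have := mulr_ge0 (mulr_ge0 (ltW (ltr0Sn R 7)) (ltW p0)) (powR_ge0 16 (p - 1)).
  by have := powR_ge0 (25 : R) p; rewrite /K2; lra.
pose L := (2 * K1) `^ (b^-1).
have L0 : 0 <= L by apply: powR_ge0.
exists (2 * K2 + 2 * K1 * L `^ mu).
  apply: ltr_wpDr; last lra.
  have := mulr_ge0 (ltW K10) (powR_ge0 L mu); lra.
exists (fun X Y => 2 * (X `^ p - K1 * (X `^ mu * Y `^ b) - K2 * Y `^ p)).
exists (fun X Y => 2 * (2 * p * X `^ (p - 1) - K1 * (2 * mu * X `^ (mu - 1) * Y `^ b))).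
split.
- by rewrite !powR0 ?gt_eqF//; lra.
- move=> X Y c D X0 Y0 D0 cXD.
  set X' := X + 2 * c + D; set Y' := Y + D.
  have X'0 : 0 <= X'.
    have : (2 * c) ^+ 2 <= (X + D) ^+ 2 by have := sqr_ge0 (X - D); lra.
    by move=> /(sqr_le_bounds (addr_ge0 X0 D0))/andP[]; rewrite /X'; lra.
  have Y'0 : 0 <= Y' by rewrite addr_ge0.
  have br1 : X' `^ mu * (Y' `^ b - Y `^ b) <=
      X' `^ mu * Y' `^ b - X `^ mu * Y `^ b - 2 * mu * X `^ (mu - 1) * Y `^ b * c.
    have := powR_ge_tangent mu1 X0 X'0.
    have XD := mulr_ge0 (mulr_ge0 (ltW mu0) (powR_ge0 X (mu - 1))) D0.
    have -> : X' - X = 2 * c + D by rewrite /X'; lra.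
    move=> h; have : X `^ mu + 2 * mu * X `^ (mu - 1) * c <= X' `^ mu by lra.
    move=> /(ler_wpM2r (powR_ge0 Y b)); lra.
  have Yb : 0 <= Y' `^ b - Y `^ b.
    by rewrite subr_ge0; apply: powR_le; rewrite /Y'; lra.
  have br10 : 0 <= X' `^ mu * (Y' `^ b - Y `^ b) by rewrite mulr_ge0 ?powR_ge0.
  have br2 := powR_add_ge (ltW p1) Y0 D0; rewrite -/Y' in br2.
  suff : X' `^ p <= X `^ p + 2 * p * X `^ (p - 1) * c +
      K1 * (X' `^ mu * (Y' `^ b - Y `^ b)) + K2 * (D * Y' `^ (p - 1)).
    by have := ler_wpM2l (ltW K10) br1; have := ler_wpM2l (ltW K20) br2; lra.
  have DY0 : 0 <= D * Y' `^ (p - 1) by rewrite mulr_ge0 ?powR_ge0.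
  (* the increment [d] is at least a quarter of [x] in norm *)
  have [XD|DX] := leP X (16 * D).
    have /(sqr_le_bounds _)/andP[] : c ^+ 2 <= (4 * D) ^+ 2 by nra.
      by lra.
    move=> c1 c2.
    have DpY : D `^ p <= D * Y' `^ (p - 1).
      rewrite -(mulr_powRB1 D0 p0) ler_wpM2l//.
      by apply: powR_le => //; rewrite /Y'; lra.
    have l1 : X' `^ p <= 25 `^ p * D `^ p.
      by rewrite -powRM//; apply: powR_le => //; [lra|rewrite /X'; lra].
    have l2 : X `^ (p - 1) <= 16 `^ (p - 1) * D `^ (p - 1).
      by rewrite -powRM//; apply: powR_le; lra.
    have l3 : X `^ (p - 1) * - c <= 4 * 16 `^ (p - 1) * D `^ p.
      rewrite -(mulr_powRB1 D0 p0).
      have -> : 4 * 16 `^ (p - 1) * (D * D `^ (p - 1)) =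
        (16 `^ (p - 1) * D `^ (p - 1)) * (4 * D) by lra.
      apply: (@le_trans _ _ (X `^ (p - 1) * (4 * D))).
        by rewrite ler_wpM2l ?powR_ge0//; lra.
      by rewrite ler_wpM2r//; lra.
    have l4 : K2 * D `^ p <= K2 * (D * Y' `^ (p - 1)) by rewrite ler_pM2l.
    have := mulr_ge0 (ltW C'0) (powR_ge0 D p).
    have := powR_ge0 X p.
    have := mulr_ge0 (ltW K10) br10.
    have := ler_wpM2l (ltW p0) l3.
    rewrite /K2 in l4 *; lra.
  have Xgt0 : 0 < X by lra.
  have /(sqr_le_bounds _)/andP[] : c ^+ 2 <= (X / 4) ^+ 2 by nra.
    by lra.
  move=> c1 c2.
  have taylor : X' `^ p <= X `^ p + 2 * p * X `^ (p - 1) * c + C' * (D * X `^ (p - 1)).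
    pose z := (2 * c + D) / X.
    have zX : z * X = 2 * c + D by rewrite divfK// gt_eqF.
    have zb : -1 <= z <= 1.
      by rewrite ler_pdivlMr// ler_pdivrMr//; apply/andP; split; lra.
    have X'E : X' = X * (1 + z) by rewrite mulrDr mulr1 (mulrC X z) zX /X'; lra.
    rewrite X'E powRM//; last by lra.
    have := ler_wpM2l (powR_ge0 X p) (HK z zb).
    rewrite -(mulr_powRB1 X0 p0).
    have z2 : X * z ^+ 2 <= 9 * D.
      have : (X * z ^+ 2) * X <= 9 * D * X.
        have -> : X * z ^+ 2 * X = (z * X) ^+ 2 by ring.
        by rewrite zX; nra.
      by rewrite ler_pM2r.
    have := ler_wpM2l (mulr_ge0 K0 (powR_ge0 X (p - 1))) z2.
    have : X * X `^ (p - 1) * (p * z) = X `^ (p - 1) * p * (2 * c + D).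
      by rewrite -zX; ring.
    rewrite /C'; lra.
  have [XY|YX] := leP X Y'.
    have : X `^ (p - 1) <= Y' `^ (p - 1) by apply: powR_le; lra.
    move=> /(ler_wpM2l (mulr_ge0 (ltW C'0) D0)).
    have : C' * (D * Y' `^ (p - 1)) <= K2 * (D * Y' `^ (p - 1)).
      rewrite ler_wpM2r// /K2 -addrA lerDl.
      by rewrite addr_ge0 ?mulr_ge0 ?powR_ge0//; lra.
    have := mulr_ge0 (ltW K10) br10; lra.
  have [D00|DN0] := eqVneq D 0.
    have := mulr_ge0 (ltW K10) br10; have := mulr_ge0 (ltW K20) DY0.
    by rewrite D00 in taylor *; lra.
  have Dgt0 : 0 < D by rewrite lt_neqAle eq_sym DN0.
  have Y'gt0 : 0 < Y' by rewrite /Y'; lra.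
  have t1 : b * (D * X `^ (b - 1)) <= Y' `^ b - Y `^ b.
    have := powR_le_tangent (introT andP (conj b0 b1)) Y'gt0 Y0.
    have : X `^ (b - 1) <= Y' `^ (b - 1) by apply: powR_le_anti; lra.
    have bD : 0 <= b * D by rewrite mulr_ge0// ltW.
    move=> /(ler_wpM2l bD).
    have -> : Y - Y' = - D by rewrite /Y'; lra.
    lra.
  have t2 : 2^-1 `^ mu * X `^ mu <= X' `^ mu.
    by rewrite -powRM//; apply: powR_le; rewrite /X'; lra.
  have t3 : 2^-1 `^ mu * X `^ mu * (b * (D * X `^ (b - 1))) <=
      X' `^ mu * (Y' `^ b - Y `^ b).
    by apply: ler_pM => //; rewrite ?mulr_ge0 ?powR_ge0 ?ltW.
  have Xpw : X `^ mu * X `^ (b - 1) = X `^ (p - 1).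
    rewrite -powRD ?(gt_eqF Xgt0) ?implybT//.
    by have -> : mu + (b - 1) = p - 1 by lra.
  have t4 : C' * (D * X `^ (p - 1)) <= K1 * (X' `^ mu * (Y' `^ b - Y `^ b)).
    apply: le_trans (ler_wpM2l (ltW K10) t3).
    by rewrite -K1E -Xpw le_eqVlt; apply/orP; left; apply/eqP; ring.
  have := mulr_ge0 (ltW K20) DY0; lra.
- move=> X Y X0 Y0.
  have Ep Z : Z `^ p = Z `^ mu * Z `^ b by rewrite pE powRD// gt_eqF// -pE.
  have Xm := powR_ge0 X mu; have Yb := powR_ge0 Y b.
  have LM : 0 <= K1 * L `^ mu * Y `^ p.
    by apply: mulr_ge0 (powR_ge0 _ _); apply: mulr_ge0 (powR_ge0 _ _); lra.
  (* [L] is chosen so that [2 * K1 * Y `^ b <= X `^ b] as soon as [L * Y <= X] *)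
  have [LY|LY] := leP (L * Y) X.
    have : 2 * K1 * Y `^ b <= X `^ b.
      have -> : 2 * K1 = L `^ b.
        rewrite /L -powRrM mulVf ?gt_eqF// powRr1//; lra.
      by rewrite -powRM//; apply: powR_le => //; [lra|rewrite mulr_ge0].
    by move=> /(ler_wpM2l Xm); rewrite -Ep; lra.
  have : X `^ mu <= L `^ mu * Y `^ mu.
    by rewrite -powRM//; apply: powR_le => //; lra.
  have KY : 0 <= 2 * K1 * Y `^ b by apply: mulr_ge0 => //; lra.
  have := powR_ge0 X p.
  move=> Xp /(ler_wpM2l KY); rewrite (Ep Y); lra.
Qed.

Lemma bellman_exists p : 2^-1 <= p -> exists2 C, 0 < C &
  exists Phi Gam, bellman p C Phi Gam.
Proof.
move=> p2; have [p1|p1] := leP p 1; last exact: bellman_gt1.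
by apply: bellman_le1; rewrite p2.
Qed.

End Bellman.

(** * Averages over equally spaced points and reverse martingales *)

Section Martingale.
Context {R : realType}.

Definition avg (N : nat) (phi : R -> R) (t : R) : R :=
  \sum_(j < N) phi (t + j%:R / N%:R).

Lemma avg_le N (phi psi : R -> R) t : (forall s, phi s <= psi s) ->
  avg N phi t <= avg N psi t.
Proof. by move=> H; apply: ler_sum => j _; exact: H. Qed.

Lemma avgD N (phi psi : R -> R) t :
  avg N (fun s => phi s + psi s) t = avg N phi t + avg N psi t.
Proof. exact: big_split. Qed.

Lemma avgZ N (k : R) (phi : R -> R) t :
  avg N (fun s => k * phi s) t = k * avg N phi t.
Proof. by rewrite /avg mulr_sumr. Qed.

Lemma avg_shift N (phi : R -> R) m t : (0 < N)%N -> periodic phi 1 ->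
  avg N (fun s => phi (s + m%:R / N%:R)) t = avg N phi t.
Proof.
move=> N0 per; have NN0 : N%:R != 0 :> R by rewrite pnatr_eq0 -lt0n.
elim: m => [|m <-].
  by apply: eq_bigr => j _; rewrite mul0r addr0.
rewrite /avg; case: N N0 NN0 => // N _ NN0.
rewrite big_ord_recr [in RHS]big_ord_recl /= addrC; congr (_ + _).
  rewrite -[RHS]per; congr phi; rewrite -natr1.
  rewrite -(natr1 N) in NN0 *; field.
  exact: NN0.
apply: eq_bigr => j _; congr phi.
by rewrite /bump /= add1n -!natr1; ring.
Qed.

(** Shifting by [j * h] does not change the average; averaging over [j] then
replaces [F] by the mean of its translates, which vanishes, and leaves the
[h]-periodic factor [G] unchanged. *)
Lemma avg_orthogonal N p h (G F : R -> R) t : (0 < N)%N -> (0 < p)%N ->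
  (exists m, h = m%:R / N%:R) ->
  periodic G h -> periodic G 1 -> periodic F 1 ->
  (forall s, \sum_(j < p) F (s + j%:R * h) = 0) ->
  avg N (fun s => G s * F s) t = 0.
Proof.
move=> N0 p0 [m hE] Gh G1 F1 F0.
have : \sum_(j < p) avg N (fun s => G s * F s) t = 0.
  transitivity (\sum_(j < p) avg N (fun s => G s * F (s + j%:R * h)) t).
    apply: eq_bigr => j _.
    rewrite -(@avg_shift N _ (j * m)%N t N0); last by move=> s; rewrite G1 F1.
    apply: eq_bigr => i _; congr (_ * F (_ + _)).
      by rewrite natrM -mulrA -hE [j%:R * h]mulr_natl (periodicn Gh).
    by rewrite natrM -mulrA -hE.
  rewrite /avg exchange_big big1 //= => i _.
  by rewrite -mulr_sumr F0 mulr0.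
rewrite sumr_const card_ord => /eqP; rewrite mulrn_eq0 => /orP[|/eqP//].
by rewrite -leqn0 leqNgt p0.
Qed.

Lemma cauchy_schwarz (I : finType) (x y : I -> R) :
  (\sum_i x i * y i) ^+ 2 <= (\sum_i x i ^+ 2) * (\sum_i y i ^+ 2).
Proof.
set a := \sum_i x i ^+ 2; set b := \sum_i y i ^+ 2; set c := \sum_i _ * _.
have Q (u v : R) : 0 <= u ^+ 2 * a + 2 * (u * v * c) + v ^+ 2 * b.
  have -> : u ^+ 2 * a + 2 * (u * v * c) + v ^+ 2 * b =
      \sum_i (u * x i + v * y i) ^+ 2.
    rewrite !mulr_sumr -!big_split /=; apply: eq_bigr => i _; ring.
  by apply: sumr_ge0 => i _; exact: sqr_ge0.
have [a0|aN0] := eqVneq a 0.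
  have := Q b (- c); have := Q 1 (- c); have := Q (b + 1) (-c).
  rewrite a0 !mul0r; have b0 : 0 <= b by apply: sumr_ge0 => i _; exact: sqr_ge0.
  nra.
have agt0 : 0 < a.
  by rewrite lt_neqAle eq_sym aN0; apply: sumr_ge0 => i _; exact: sqr_ge0.
have := Q (- c) a.
have -> : (- c) ^+ 2 * a + 2 * (- c * a * c) + a ^+ 2 * b = a * (a * b - c ^+ 2) by ring.
by rewrite pmulr_rge0// subr_ge0.
Qed.

Variables (p C : R) (Phi Gam : R -> R -> R).
Hypothesis bel : bellman p C Phi Gam.

(** The periodicity of [F k] and the vanishing of its means over [l]
translates say that the [F k] are the increments of a reverse martingale,
started at [k = K] from zero and run down to [k = 0]. *)
Lemma reverse_martingale_bound (I : finType) (l K N : nat) (F : nat -> I -> R -> R) t :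
  (0 < l)%N -> (0 < N)%N -> (l ^ K %| N)%N ->
  (forall k j i, (j <= k)%N -> periodic (F k i) (l ^ j)%:R^-1) ->
  (forall k i s, \sum_(j < l) F k i (s + j%:R * (l ^ k.+1)%:R^-1) = 0) ->
  avg N (fun s => (\sum_i (\sum_(k < K) F k i s) ^+ 2) `^ p) t <=
  C * avg N (fun s => (\sum_i \sum_(k < K) F k i s ^+ 2) `^ p) t.
Proof.
move=> l0 N0 lN per zero; case: bel => Phi0 Phid Phige.
pose x m i s := \sum_(m <= k < K) F k i s.
pose X m s := \sum_i x m i s ^+ 2.
pose Y m s := \sum_i \sum_(m <= k < K) F k i s ^+ 2.
have xper m j i : (j <= m)%N -> periodic (x m i) (l ^ j)%:R^-1.
  move=> jm s; apply: eq_big_nat => k /andP[mk _].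
  by rewrite per// (leq_trans jm).
have Xper m j : (j <= m)%N -> periodic (X m) (l ^ j)%:R^-1.
  by move=> jm s; apply: eq_bigr => i _; rewrite xper.
have Yper m j : (j <= m)%N -> periodic (Y m) (l ^ j)%:R^-1.
  move=> jm s; apply: eq_bigr => i _; apply: eq_big_nat => k /andP[mk _].
  by rewrite per// (leq_trans jm).
have per1 (f : R -> R) : periodic f (l ^ 0)%:R^-1 -> periodic f 1.
  by rewrite expn0 invr1.
have X0 m s : 0 <= X m s by apply: sumr_ge0 => i _; exact: sqr_ge0.
have Y0 m s : 0 <= Y m s.
  by apply: sumr_ge0 => i _; apply: sumr_ge0 => k _; exact: sqr_ge0.
have step m : (m < K)%N ->
    avg N (fun s => Phi (X m s) (Y m s)) t <=
    avg N (fun s => Phi (X m.+1 s) (Y m.+1 s)) t.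
  move=> mK.
  (* the step from time [m.+1] to [m], with increment [F m] *)
  have pw s : Phi (X m s) (Y m s) <= Phi (X m.+1 s) (Y m.+1 s) +
      \sum_i Gam (X m.+1 s) (Y m.+1 s) * x m.+1 i s * F m i s.
    under eq_bigr do rewrite -mulrA.
    rewrite -mulr_sumr.
    have -> : X m s = X m.+1 s + 2 * (\sum_i x m.+1 i s * F m i s) +
        \sum_i F m i s ^+ 2.
      rewrite mulr_sumr -!big_split /=; apply: eq_bigr => i _.
      by rewrite /x big_ltn//; ring.
    have -> : Y m s = Y m.+1 s + \sum_i F m i s ^+ 2.
      rewrite -big_split /=; apply: eq_bigr => i _.
      by rewrite [LHS]big_ltn// addrC.
    apply: Phid => //; last exact: cauchy_schwarz.
    by apply: sumr_ge0 => i _; exact: sqr_ge0.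
  apply: le_trans (avg_le _ _ pw) _.
  rewrite avgD [X in _ + X](_ : _ = 0) ?addr0// /avg exchange_big /= big1// => i _.
  apply: (@avg_orthogonal N l (l ^ m.+1)%:R^-1
    (fun s => Gam (X m.+1 s) (Y m.+1 s) * x m.+1 i s) (F m i) t N0 l0).
  - have /dvdnP[d NE] : (l ^ m.+1 %| N)%N by apply: dvdn_trans lN; exact: dvdn_exp2l.
    exists d; rewrite NE natrM invfM mulrA divff ?mul1r//.
    by rewrite pnatr_eq0; apply: contraTneq N0; rewrite NE => ->.
  - by move=> s; rewrite Xper// Yper// xper.
  - by apply: per1 => s; rewrite Xper// Yper// xper.
  - by apply: per1; exact: per.
  - exact: zero.
have all m : (m <= K)%N -> avg N (fun s => Phi (X (K - m)%N s) (Y (K - m)%N s)) t <= 0.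
  elim: m => [_|m IH mK].
    rewrite subn0 /avg; apply: sumr_le0 => j _.
    have XK s : X K s = 0 by rewrite /X big1// => i _; rewrite /x big_geq// expr0n.
    have YK s : Y K s = 0 by rewrite /Y big1// => i _; rewrite big_geq.
    by rewrite XK YK.
  apply: le_trans (IH (ltnW mK)).
  have -> : (K - m = (K - m.+1).+1)%N by rewrite subnS prednK// subn_gt0.
  by apply: step; rewrite ltn_subrL/= (leq_trans _ mK).
have := all K (leqnn K); rewrite subnn => le0.
apply: (@le_trans _ _ (avg N (fun s => Phi (X 0%N s) (Y 0%N s) + C * Y 0%N s `^ p) t)).
  apply: avg_le => s; apply: le_trans (Phige _ _ (X0 0%N s) (Y0 0%N s)).
  rewrite (_ : \sum_i _ = X 0%N s)//.
  by apply: eq_bigr => i _; rewrite /x big_mkord.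
rewrite avgD -[leRHS]add0r lerD// avgZ le_eqVlt; apply/orP; left; apply/eqP.
congr (_ * _); apply: eq_bigr => j _; congr (_ `^ _); apply: eq_bigr => i _.
by rewrite big_mkord.
Qed.

End Martingale.

(** * Integrals of averages *)

Section Integral.
Context {R : realType}.
Local Notation mu := (@lebesgue_measure R).

Lemma measurable_shift (h : R) :
  @measurable_fun _ _ (measurableTypeR R) (measurableTypeR R) setT (fun x => x + h).
Proof. by apply: measurable_funD. Qed.

Lemma lebesgue_measure_shift (h : R) (A : set R) : measurable A ->
  mu A = mu ((fun x : R => x + h) @^-1` A).
Proof.
pose f : {mfun (measurableTypeR R) >-> (measurableTypeR R)} :=
  HB.pack (fun x : R => x + h) (isMeasurableFun.Build _ _ _ _ _ (measurable_shift h)).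
move=> mA.
apply: (@lebesgue_measure_unique R (pushforward mu f)) => // _ [[a b] _ <-] /=.
rewrite /pushforward.
have -> : f @^-1` `]a, b] = `]a - h, b - h]%classic.
  by apply/seteqP; split => x /=; rewrite !in_itv /= ltrBlDr lerBrDr.
rewrite !lebesgue_measure_itv /= !lte_fin ltrD2r.
by case: ifP => // _; rewrite -!EFinB; congr (_%:E); ring.
Qed.

Lemma ge0_integral_shift (h : R) (D : set R) (phi : R -> R) : measurable D ->
  measurable_fun setT phi -> (forall x, 0 <= phi x) ->
  (\int[mu]_(x in D) (phi x)%:E =
   \int[mu]_(x in (fun x : R => x + h)%R @^-1` D) (phi (x + h)%R)%:E)%E.
Proof.
move=> mD mphi phi0.
have mf : @measurable_fun _ _ (measurableTypeR R) _ D (fun x => (phi x)%:E).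
  by apply/measurable_EFinP; exact: measurable_funTS.
have f0 : {in D, forall y, (0 <= (phi y)%:E)%E} by move=> x _; rewrite lee_fin.
have <- := @ge0_integral_pushforward _ _ (measurableTypeR R)
  (measurableTypeR R) R _ (measurable_shift h) lebesgue_measure D _ mD mf f0.
apply: eq_measure_integral; first exact: measurable_shift.
by move=> ? A mA _; exact: lebesgue_measure_shift.
Qed.

(** The shifted period is cut at [1], and its part beyond [1] is moved back by
one period. *)
Lemma integral_periodic_shift (h : R) (phi : R -> R) : 0 <= h <= 1 ->
  measurable_fun setT phi -> (forall x, 0 <= phi x) -> periodic phi 1 ->
  (\int[mu]_(x in `]0%R, 1%R]) (phi (x + h)%R)%:E =
   \int[mu]_(x in `]0%R, 1%R]) (phi x)%:E)%E.
Proof.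
move=> /andP[h0 h1] mphi phi0 per.
have mE (D : set R) : measurable_fun D (fun x => (phi x)%:E).
  by apply/measurable_EFinP; exact: measurable_funTS.
have split3 (a b c : R) : a <= b -> b <= c ->
    (\int[mu]_(x in `]a, c]) (phi x)%:E =
     \int[mu]_(x in `]a, b]) (phi x)%:E + \int[mu]_(x in `]b, c]) (phi x)%:E)%E.
  move=> ab bc.
  have -> : `]a, c]%classic = `]a, b]%classic `|` `]b, c]%classic.
    by rewrite -itv_bndbnd_setU// bnd_simp.
  apply: ge0_integral_setU; [exact: measurable_itv|exact: measurable_itv|..].
  - exact: mE.
  - by move=> x _; rewrite lee_fin.
  - by apply/disj_setPS => x []/=; rewrite !in_itv /= => /andP[_ xb] /andP[bx _]; lra.
have pre (a b k : R) : (fun x : R => x + k) @^-1` `]a + k, b + k] = `]a, b]%classic.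
  by apply/seteqP; split => x /=; rewrite !in_itv /= ltrD2r lerD2r.
have := ge0_integral_shift h (measurable_itv `]0 + h, 1 + h]) mphi phi0.
rewrite pre => <-; rewrite add0r (split3 h 1 (1 + h)) ?lerDl//.
have := ge0_integral_shift 1 (measurable_itv `]0 + 1, h + 1]) mphi phi0.
rewrite pre add0r (addrC h) => ->.
under [X in (_ + X)%E]eq_integral do rewrite per.
by rewrite (split3 0 h 1)// addeC.
Qed.

Lemma measurable_avg N (phi : R -> R) : measurable_fun setT phi ->
  measurable_fun setT (avg N phi).
Proof.
move=> mphi; apply: measurable_sum => j.
have : measurable_fun setT (fun x : R => phi (x + j%:R / N%:R)).
  exact: measurableT_comp mphi (measurable_shift _).
by [].
Qed.

Lemma integral_avg N (phi : R -> R) : (0 < N)%N ->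
  measurable_fun setT phi -> (forall x, 0 <= phi x) -> periodic phi 1 ->
  (\int[mu]_(x in `[0%R, 1%R]) (avg N phi x)%:E =
   N%:R%:E * \int[mu]_(x in `[0%R, 1%R]) (phi x)%:E)%E.
Proof.
move=> N0 mphi phi0 per.
have msh (h : R) : measurable_fun setT (fun x : R => phi (x + h)).
  exact: measurableT_comp mphi (measurable_shift h).
have mE (D : set R) (f : R -> R) : measurable_fun setT f ->
    measurable_fun D (fun x => (f x)%:E).
  by move=> mf; apply/measurable_EFinP; exact: measurable_funTS.
have mavg := measurable_avg N mphi.
(* half-open periods can be cut into disjoint pieces and translated *)
rewrite -!integral_itv_obnd_cbnd; [|exact: mE..].
under eq_integral do rewrite /avg -sumEFin.
rewrite ge0_integral_sum//; last 2 first.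
- by move=> j; exact: mE.
- by move=> j x _; rewrite lee_fin.
transitivity (\sum_(j < N) \int[mu]_(x in `]0%R, 1%R]) (phi x)%:E)%E.
  apply: eq_bigr => j _; apply: integral_periodic_shift => //.
  by rewrite divr_ge0//= ler_pdivrMr ?ltr0n// mul1r ler_nat ltnW.
under eq_bigr do rewrite -(mul1e (integral _ _ _)).
by rewrite -ge0_sume_distrl// sumEFin sumr_const card_ord.
Qed.

Lemma ge0_le_integral_avg N (C : R) (phi psi : R -> R) : (0 < N)%N -> 0 <= C ->
  measurable_fun setT phi -> (forall x, 0 <= phi x) -> periodic phi 1 ->
  measurable_fun setT psi -> (forall x, 0 <= psi x) -> periodic psi 1 ->
  (forall t, avg N phi t <= C * avg N psi t) ->
  (\int[mu]_(x in `[0%R, 1%R]) (phi x)%:E <=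
   C%:E * \int[mu]_(x in `[0%R, 1%R]) (psi x)%:E)%E.
Proof.
move=> N0 C0 mphi phi0 phi1 mpsi psi0 psi1 H.
have NN : 0 < N%:R :> R by rewrite ltr0n.
have avg0 (f : R -> R) t : (forall x, 0 <= f x) -> 0 <= avg N f t.
  by move=> f0; apply: sumr_ge0.
have mE (f : R -> R) : measurable_fun setT f ->
    measurable_fun (`[0, 1]%classic : set R) (fun x => (f x)%:E).
  by move=> mf; apply/measurable_EFinP; exact: measurable_funTS.
rewrite -(@lee_pmul2l _ N%:R%:E) ?lte_fin//.
have mphi' := mE _ (measurable_avg N mphi).
have mpsi' := mE _ (measurable_avg N mpsi).
have psi0' (x : R) : `[0, 1]%classic x -> (0 <= (avg N psi x)%:E)%E.
  by move=> _; rewrite lee_fin avg0.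
rewrite muleCA -!integral_avg//.
have <- := ge0_integralZl_EFin lebesgue_measure (measurable_itv _) psi0' mpsi' C0.
apply: ge0_le_integral; first exact: measurable_itv.
- by move=> x _; rewrite lee_fin avg0.
- exact: mphi'.
- exact: measurable_funeM.
- by move=> x _; rewrite -EFinM lee_fin.
Qed.

End Integral.

(** * Trigonometric sums *)

Section TrigSums.
Context {R : realType}.
Implicit Types (x t : R) (z w : R[i]) (s : seq int) (c : int -> R[i]) (chi : pred int).
Local Notation Re := (@complex.Re R).
Local Notation Im := (@complex.Im R).

Lemma sqr_cmod z : cmod z ^+ 2 = Re z ^+ 2 + Im z ^+ 2.
Proof. by case: z => a b; rewrite /cmod /= sqr_sqrtr// addr_ge0 ?sqr_ge0. Qed.

Lemma ReD z w : Re (z + w) = Re z + Re w.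
Proof. by case: z; case: w. Qed.

Lemma ImD z w : Im (z + w) = Im z + Im w.
Proof. by case: z; case: w. Qed.

Lemma Re_sum I (s : seq I) (P : pred I) (F : I -> R[i]) :
  Re (\sum_(i <- s | P i) F i) = \sum_(i <- s | P i) Re (F i).
Proof. exact: (big_morph _ ReD). Qed.

Lemma Im_sum I (s : seq I) (P : pred I) (F : I -> R[i]) :
  Im (\sum_(i <- s | P i) F i) = \sum_(i <- s | P i) Im (F i).
Proof. exact: (big_morph _ ImD). Qed.

Lemma e0 : e 0 = 1 :> R[i].
Proof. by rewrite /e mulr0 cos0 sin0. Qed.

Lemma eD x y : e (x + y) = e x * e y :> R[i].
Proof.
rewrite /e mulrDr cosD sinD; apply/eqP; rewrite eq_complex /=.
by rewrite eqxx /= addrC [X in _ + X]mulrC [X in X + _]mulrC.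
Qed.

Lemma e_nat (n : nat) : e n%:R = 1 :> R[i].
Proof.
elim: n => [|n IH]; first exact: e0.
rewrite -natr1 eD IH mul1r /e mulr1.
have -> : 2 * pi = pi *+ 2 :> R by rewrite mulr_natl.
by rewrite cos2pi sin2pi.
Qed.

Lemma e_int (n : int) : e n%:~R = 1 :> R[i].
Proof.
case: n => n; first exact: e_nat.
rewrite NegzE mulrNz.
have := eD (- n.+1%:R) n.+1%:R; rewrite addNr e0 e_nat mulr1 => <-//.
Qed.

Lemma eMn x (n : nat) : e (n%:R * x) = e x ^+ n :> R[i].
Proof.
elim: n => [|n IH]; first by rewrite mul0r e0 expr0.
by rewrite -natr1 mulrDl mul1r eD IH exprSr.
Qed.

(** After reduction of [m] modulo [l], the real part is
[1 - 2 sin (pi b / l) ^ 2] with [0 < b < l]. *)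
Lemma e_frac_neq1 (m l : nat) : (0 < l)%N -> ~~ (l %| m)%N -> e (m%:R / l%:R) != 1 :> R[i].
Proof.
move=> l0 lm; have l0R : 0 < l%:R :> R by rewrite ltr0n.
rewrite (divn_eq m l) natrD natrM mulrDl mulfK ?(gt_eqF l0R)// eD e_nat mul1r.
set b := (m %% l)%N.
have b0 : 0 < b%:R :> R by rewrite ltr0n lt0n.
have bl : b%:R < l%:R :> R by rewrite ltr_nat ltn_pmod.
have p0 := pi_gt0 R.
have s0 : 0 < sin (pi * (b%:R / l%:R)) :> R.
  apply: sin_gt0_pi; rewrite mulr_gt0 ?divr_gt0//=.
  by rewrite gtr_pMr// ltr_pdivrMr// mul1r.
rewrite eq_complex negb_and; apply/orP; left => /=.
have -> : 2 * pi * (b%:R / l%:R) = (pi * (b%:R / l%:R)) *+ 2 :> R.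
  by ring.
rewrite mulr2n cosD -!expr2 cos2sin2.
by rewrite lt_eqF// -addrA -opprD gtrDl oppr_lt0 addr_gt0 ?exprn_gt0.
Qed.

(** All pieces of one polynomial are described by predicates on its
frequencies, so that refining the pieces is taking conjunctions. *)
Definition trig_sum (s : seq int) (c : int -> R[i]) (chi : pred int) (t : R) : R[i] :=
  \sum_(n <- s | chi n) c n * e (n%:~R * t).

Lemma trig_sum_periodic s c chi (d : nat) : (0 < d)%N ->
  {in s, forall n, chi n -> (d %| `|n|)%N} ->
  periodic (trig_sum s c chi) d%:R^-1.
Proof.
move=> d0 H t; rewrite /trig_sum [LHS]big_seq_cond [RHS]big_seq_cond.
apply: eq_bigr => n /andP[ns chin].
have /dvdzP[m ->] : (d%:Z %| n)%Z by rewrite dvdzE /= H.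
rewrite mulrDr eD intrM mulfK ?e_int ?mulr1//.
by rewrite pnatr_eq0 -lt0n.
Qed.

(** Each frequency [n] contributes a geometric sum whose ratio [w] is a
nontrivial [l]-th root of unity, because [n / l ^ k] is an integer prime
to [l]. *)
Lemma sum_trig_sum_shift s c chi (l k : nat) t : prime l ->
  {in s, forall n, chi n -> n != 0 /\ logn l `|n| = k} ->
  \sum_(j < l) trig_sum s c chi (t + j%:R * (l ^ k.+1)%:R^-1) = 0.
Proof.
move=> lp H; have l0 := prime_gt0 lp.
rewrite exchange_big /= big_seq_cond big1// => n /andP[ns chin].
have [n0 nk] := H n ns chin.
set h : R := (l ^ k.+1)%:R^-1; set w : R[i] := e (n%:~R * h).
under eq_bigr do rewrite mulrDr eD (mulrCA n%:~R) eMn mulrA -/w.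
rewrite -mulr_sumr; suff -> : \sum_(j < l) w ^+ j = 0 by rewrite mulr0.
have n_gt0 : (0 < `|n|)%N by rewrite absz_gt0.
have [m lm nE] := pfactor_coprime lp n_gt0.
have lk0 : (l ^ k)%:R != 0 :> R by rewrite pnatr_eq0 -lt0n expn_gt0 l0.
have lR0 : l%:R != 0 :> R by rewrite pnatr_eq0 -lt0n.
have ah : `|n|%N%:R * h = m%:R / l%:R.
  rewrite nE nk /h expnS !natrM; field.
  by rewrite lR0 lk0.
have w1 : w != 1.
  have lNm : ~~ (l %| m)%N by rewrite -prime_coprime.
  have := e_frac_neq1 l0 lNm; rewrite -ah; apply: contraNN => /eqP w1.
  have [n_ge0|n_lt0] := leP 0 n.
    by rewrite -w1 /w -[in X in _ == X](gez0_abs n_ge0).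
  have := eD (n%:~R * h) (- (n%:~R * h)).
  rewrite subrr e0 -/w w1 mul1r -mulNr -mulrNz -(ltz0_abs n_lt0) => e1.
  by rewrite e1.
have wl : w ^+ l = 1.
  rewrite -eMn.
  have /dvdzP[d ->] : ((l ^ k)%N%:Z %| n)%Z by rewrite dvdzE /= nE nk dvdn_mull.
  rewrite intrM /h expnS natrM.
  have -> : l%:R * (d%:~R * (l ^ k)%:R * (l%:R * (l ^ k)%:R)^-1) = d%:~R :> R.
    by field; rewrite lR0 lk0.
  exact: e_int.
have := subrX1 w l; rewrite wl subrr => /esym/eqP.
by rewrite mulf_eq0 subr_eq0 (negPf w1) => /eqP.
Qed.

End TrigSums.

(** * The square function inequality at equally spaced points *)

Section Primes.
Context {R : realType}.
Local Notation Re := (@complex.Re R).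
Local Notation Im := (@complex.Im R).
Variables (p C : R) (Phi Gam : R -> R -> R) (s : seq int) (c : int -> R[i]).
Hypothesis bel : bellman p C Phi Gam.

Lemma trig_sum_split (K : nat) (chi : pred int) (v : int -> nat) t :
  {in s, forall n, (v n < K)%N} ->
  \sum_(k < K) trig_sum s c (fun n => chi n && (v n == k)) t = trig_sum s c chi t.
Proof.
move=> vK; rewrite /trig_sum.
under eq_bigr do rewrite big_mkcondr.
rewrite exchange_big /= big_seq_cond [RHS]big_seq_cond.
apply: eq_bigr => n /andP[ns _].
rewrite (bigD1 (Ordinal (vK n ns))) //= eqxx big1 ?addr0// => k.
by rewrite -val_eqE /= eq_sym => /negPf ->.
Qed.

(** The family of all [trig_sum s c (chi i)] is treated as one martingale with
values in a Euclidean space; its real coordinates are indexed by [I * bool],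
the boolean selecting the real or the imaginary part. *)
Lemma square_function_one_prime (I : finType) (chi : I -> pred int) (l K N : nat) t :
  prime l -> (0 < N)%N -> (l ^ K %| N)%N ->
  {in s, forall n, n != 0 /\ (logn l `|n| < K)%N} ->
  avg N (fun u => (\sum_i cmod (trig_sum s c (chi i) u) ^+ 2) `^ p) t <=
  C * avg N (fun u => (\sum_i \sum_(k < K)
    cmod (trig_sum s c (fun n => chi i n && (logn l `|n| == k)) u) ^+ 2) `^ p) t.
Proof.
move=> lp N0 lN sK; have l0 := prime_gt0 lp.
pose T k i := trig_sum s c (fun n => chi i n && (logn l `|n| == k)).
pose F k (x : I * bool) u := if x.2 then Re (T k x.1 u) else Im (T k x.1 u).
have pairE (G : I * bool -> R) : \sum_x G x = \sum_i (G (i, true) + G (i, false)).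
  transitivity (\sum_i \sum_b G (i, b)).
    by rewrite pair_bigA; apply: eq_bigr => -[].
  by apply: eq_bigr => i _; rewrite big_bool.
have := @reverse_martingale_bound R p C Phi Gam bel _ l K N F t l0 N0 lN.
have -> : (fun u => (\sum_i cmod (trig_sum s c (chi i) u) ^+ 2) `^ p) =
    (fun u => (\sum_x (\sum_(k < K) F k x u) ^+ 2) `^ p).
  apply/funext => u; rewrite pairE; congr (_ `^ _); apply: eq_bigr => i _.
  rewrite sqr_cmod /F /= -Re_sum -Im_sum trig_sum_split// => n ns.
  by have [] := sK n ns.
have -> : (fun u => (\sum_i \sum_(k < K) cmod (T k i u) ^+ 2) `^ p) =
    (fun u => (\sum_x \sum_(k < K) F k x u ^+ 2) `^ p).
  apply/funext => u; rewrite pairE; congr (_ `^ _); apply: eq_bigr => i _.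
  by rewrite -big_split /=; apply: eq_bigr => k _; rewrite sqr_cmod.
apply.
- move=> k j [i b] jk.
  have Tper : periodic (T k i) (l ^ j)%:R^-1.
    apply: trig_sum_periodic; first by rewrite expn_gt0 l0.
    move=> n ns /andP[_ /eqP nk].
    have [n0 _] := sK n ns.
    by rewrite pfactor_dvdn ?absz_gt0// nk.
  by move=> u; rewrite /F /= Tper.
- move=> k [i b] u.
  have /(_ (fun n => chi i n && (logn l `|n| == k)) l k u lp) := @sum_trig_sum_shift R s c.
  rewrite -/(T k i) => H.
  have {}H : \sum_(j < l) T k i (u + j%:R * (l ^ k.+1)%:R^-1) = 0.
    by apply: H => n ns /andP[_ /eqP]; have [] := sK n ns.
  by case: b; rewrite /F /= -?Re_sum -?Im_sum H.
Qed.

Definition valuations (r : nat) (ps : r.-tuple nat) (n : int) : seq nat :=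
  [seq logn l `|n| | l <- ps].

Lemma big_tuple_cons (K r : nat) (G : seq nat -> R) :
  \sum_(w : r.+1.-tuple 'I_K) G (map val w) =
  \sum_(v : r.-tuple 'I_K) \sum_(k < K) G (val k :: map val v).
Proof.
rewrite pair_big /=.
rewrite (reindex (fun x : r.-tuple 'I_K * 'I_K => [tuple of x.2 :: x.1])) //=.
exists (fun w : r.+1.-tuple 'I_K => ([tuple of behead w], thead w)).
- by move=> [v k] _ /=; congr pair; apply/val_inj.
- by move=> w _ /=; rewrite [RHS]tuple_eta; apply/val_inj.
Qed.

Hypothesis C0 : 0 <= C.

(** Induction on the primes: the pieces for the remaining primes, indexed by
[r.-tuple 'I_K], form the family that is refined by the first prime. *)
Lemma square_function_many_primes (r : nat) (ps : r.-tuple nat) (K N : nat) t :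
  (0 < N)%N -> (forall i, prime (tnth ps i) /\ (tnth ps i ^ K %| N)%N) ->
  {in s, forall n i, n != 0 /\ (logn (tnth ps i) `|n| < K)%N} ->
  avg N (fun u => (cmod (trig_sum s c xpredT u) ^+ 2) `^ p) t <=
  C ^+ r * avg N (fun u => (\sum_(v : r.-tuple 'I_K)
    cmod (trig_sum s c (fun n => valuations ps n == map val v) u) ^+ 2) `^ p) t.
Proof.
move=> N0; elim: r ps => [|r IH] ps psN sK.
  rewrite expr0 mul1r le_eqVlt; apply/orP; left; apply/eqP.
  apply: eq_bigr => j _; congr (_ `^ _).
  rewrite (big_pred1 [tuple]) => [|v /=]; last by rewrite (tuple0 v); apply/esym/eqP.
  by congr (cmod _ ^+ 2); apply: eq_bigl => n; rewrite (tuple0 ps).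
case/tupleP: ps psN sK => l ps psN sK.
have [lp lN] := psN ord0; rewrite tnth0 in lp lN.
apply: le_trans (IH ps _ _) _.
- by move=> i; have := psN (lift ord0 i); rewrite tnthS.
- by move=> n ns i; have := sK n ns (lift ord0 i); rewrite tnthS.
rewrite exprSr -mulrA ler_wpM2l ?exprn_ge0//.
apply: le_trans (@square_function_one_prime _ _ l K N t lp N0 lN _) _.
  by move=> n ns; have := sK n ns ord0; rewrite tnth0.
rewrite ler_wpM2l// le_eqVlt; apply/orP; left; apply/eqP.
apply: eq_bigr => j _; congr (_ `^ _).
rewrite (big_tuple_cons _ _ (fun w =>
  cmod (trig_sum s c (fun n => valuations [tuple of l :: ps] n == w) _) ^+ 2)).
apply: eq_bigr => v _; apply: eq_bigr => k _; congr (cmod _ ^+ 2).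
by apply: eq_bigl => n; rewrite /valuations /= eqseq_cons andbC.
Qed.

End Primes.

(** * The pieces of a trigonometric polynomial *)

(** Since [b] is prime to [tnth ps i], it is nonzero and does not contribute to
the valuation, and neither do the other primes of [ps]. *)
Lemma logn_mpow_mul (r : nat) (ps v : r.-tuple nat) (b : int) (i : 'I_r) :
  (forall i, prime (tnth ps i)) -> uniq ps ->
  coprimez b (\prod_(i < r) tnth ps i)%N%:Z ->
  b != 0 /\ logn (tnth ps i) `|(mpow ps v)%:Z * b| = tnth v i.
Proof.
move=> psP psU bP; set l := tnth ps i; have lP : prime l := psP i.
have lb : coprime l `|b|.
  move: bP; rewrite /coprimez /= => bP.
  rewrite coprime_sym; apply: coprime_dvdr bP.
  by rewrite (bigD1 i) //= dvdn_mulr.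
have b0 : b != 0.
  by apply: contraTneq lb => ->; rewrite prime_coprime// dvdn0.
have m0 : (0 < mpow ps v)%N.
  by rewrite prodn_gt0// => j; rewrite expn_gt0 prime_gt0.
split=> //; rewrite abszM absz_nat lognM ?absz_gt0//.
rewrite (logn_coprime lb) addn0 /mpow (bigD1 i) //= lognM; last 2 first.
- by rewrite expn_gt0 prime_gt0.
- by apply: prodn_cond_gt0 => j _; rewrite expn_gt0 prime_gt0.
rewrite lognX logn_prime// eqxx muln1 logn_coprime ?addn0//.
elim/big_rec: _ => [|j x ji lx]; first exact: coprimen1.
rewrite coprimeMr lx andbT coprimeXr// prime_coprime// dvdn_prime2//.
by apply: contraNneq ji => /esym lj; apply/eqP/(tuple_uniqP _ psU).
Qed.

Section Pieces.
Context {R : realType}.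
Local Notation Re := (@complex.Re R).
Local Notation Im := (@complex.Im R).

Lemma measurable_sqr_cmod_trig_sum s (c : int -> R[i]) chi :
  measurable_fun setT (fun t : R => cmod (trig_sum s c chi t) ^+ 2).
Proof.
have mlin (n : int) : measurable_fun setT (fun t : R => 2 * pi * (n%:~R * t)).
  by apply: measurable_funM => //; apply: measurable_funM.
have mcos (n : int) : measurable_fun setT (fun t : R => cos (2 * pi * (n%:~R * t))).
  exact: measurableT_comp (continuous_measurable_fun (@continuous_cos R)) (mlin n).
have msin (n : int) : measurable_fun setT (fun t : R => sin (2 * pi * (n%:~R * t))).
  exact: measurableT_comp (continuous_measurable_fun (@continuous_sin R)) (mlin n).
under eq_fun do rewrite sqr_cmod /trig_sum -big_filter Re_sum Im_sum.
apply: measurable_funD; apply: measurable_funX; apply: measurable_sum => n.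
- have -> : (fun t => Re (c n * e (n%:~R * t))) =
     (fun t => Re (c n) * cos (2 * pi * (n%:~R * t)) -
               Im (c n) * sin (2 * pi * (n%:~R * t))).
    by apply/funext => t; case: (c n).
  by apply: measurable_funB; apply: measurable_funM.
- have -> : (fun t => Im (c n * e (n%:~R * t))) =
     (fun t => Re (c n) * sin (2 * pi * (n%:~R * t)) +
               Im (c n) * cos (2 * pi * (n%:~R * t))).
    by apply/funext => t; case: (c n).
  by apply: measurable_funD; apply: measurable_funM.
Qed.

Lemma trig_sum_periodic1 s (c : int -> R[i]) chi : periodic (trig_sum s c chi) 1.
Proof.
have /(_ s c chi 1 isT) := @trig_sum_periodic R.
by rewrite invr1; apply => n _ _; exact: dvd1n.
Qed.

Lemma fsbig_seq_supp (M : nmodType) (T : choiceType) (S : seq T) (D : set T) (F : T -> M) :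
  uniq S -> {in S, forall x, D x} -> (forall x, D x -> x \notin S -> F x = 0) ->
  \sum_(x \in D) F x = \sum_(x <- S) F x.
Proof.
move=> SU SD F0; rewrite [RHS]fsbig_seq//; symmetry; apply: fsbig_widen.
- by move=> x /= /SD.
- by move=> x [Dx /= xS]; apply: F0 => //; exact/negP.
Qed.

Lemma trig_poly_trig_sum (f : R -> R[i]) fhat : trig_poly f fhat ->
  exists2 s : seq int, uniq s & (forall n, (n \in s) = (fhat n != 0)) /\
    f = trig_sum s fhat xpredT.
Proof.
move=> [/finite_seqP[s0 s0E] fE].
have sE n : (n \in undup s0) = (fhat n != 0).
  rewrite mem_undup; apply/idP/idP => h.
    by have : [set` s0] n by []; rewrite -s0E.
  by have : [set n | fhat n != 0] n by []; rewrite s0E.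
exists (undup s0); first exact: undup_uniq.
split=> //; apply/funext => t; rewrite fE.
rewrite (@fsbig_seq_supp _ _ (undup s0))//; first exact: undup_uniq.
by move=> n _; rewrite sE negbK => /eqP ->; rewrite mul0r.
Qed.

Section Decomposition.
Variables (r : nat) (ps : r.-tuple nat) (V : set (r.-tuple nat)).
Variables (B : r.-tuple nat -> set int) (fhat : int -> R[i]) (s : seq int).
Hypothesis psP : forall i : 'I_r, prime (tnth ps i).
Hypothesis psU : uniq ps.
Hypothesis BP : forall v, V v -> forall b, B v b ->
  coprimez b (\prod_(i < r) tnth ps i)%N%:Z.
Hypothesis sU : uniq s.
Hypothesis sE : forall n, (n \in s) = (fhat n != 0).
Hypothesis sA : {in s, forall n, exists2 v, V v & exists2 b, B v b &
  n = (mpow ps v)%:Z * b}.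

Lemma valuations_mpow v b : V v -> B v b ->
  valuations ps ((mpow ps v)%:Z * b) = v.
Proof.
move=> Vv Bb; rewrite /valuations -[in RHS](map_tnth_enum v).
rewrite -[in LHS](map_tnth_enum ps) -map_comp; apply: eq_map => i /=.
by have [] := logn_mpow_mul v i psP psU (BP Vv Bb).
Qed.

(** The frequencies of the piece [v] are those of valuation vector [v]: a
frequency in [mpow ps v' * B v'] determines [v'] by its valuations. *)
Lemma piece_trig_sum v t : V v ->
  piece ps B fhat v t = trig_sum s fhat (fun n => valuations ps n == v) t.
Proof.
move=> Vv; rewrite /piece /trig_sum.
have m0 : (mpow ps v)%:Z != 0.
  rewrite -lt0n; apply: prodn_gt0 => j.
  by rewrite expn_gt0 prime_gt0.
have inj : set_inj (B v) (fun b => (mpow ps v)%:Z * b).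
  by move=> x y _ _; exact: mulfI.
rewrite -(fsbig_image _ _ (fun n => fhat n * e (n%:~R * t)) inj) -[RHS]big_filter.
apply: fsbig_seq_supp; first exact: filter_uniq.
- move=> n; rewrite mem_filter => /andP[/eqP nv /sA[v' Vv' [b Bb nE]]].
  move: nv; rewrite nE valuations_mpow// => /val_inj vv'.
  by exists b => //; rewrite -vv'.
- move=> _ [b Bb <-]; rewrite mem_filter valuations_mpow// eqxx /= sE negbK.
  by move=> /eqP ->; rewrite mul0r.
Qed.

(** Valuation vectors outside [V], or with an entry that is at least [K], do not
occur among the frequencies, so [V] may be replaced by the finite type of
vectors with entries in ['I_K]. *)
Lemma sum_sqr_piece (K : nat) t :
  {in s, forall n i, (logn (tnth ps i) `|n| < K)%N} ->
  \sum_(v \in V) cmod (piece ps B fhat v t) ^+ 2 =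
  \sum_(w : r.-tuple 'I_K)
    cmod (trig_sum s fhat (fun n => valuations ps n == map val w) t) ^+ 2.
Proof.
move=> sK.
pose g (v : r.-tuple nat) :=
  cmod (trig_sum s fhat (fun n => valuations ps n == v) t) ^+ 2.
have g0 (v : r.-tuple nat) : (forall n, n \in s -> valuations ps n != v) -> g v = 0.
  move=> H; rewrite /g /trig_sum big_seq_cond big_pred0 ?/cmod ?ComplexField.Normc.normc0 ?expr0n//.
  by move=> n; apply/negbTE/negP => /andP[/H/negPf ->].
pose S := [seq map_tuple (fun k : 'I_K => val k) w | w : r.-tuple 'I_K].
transitivity (\sum_(v <- S) g v); last by rewrite big_map big_enum.
transitivity (\sum_(v \in V) g v).
  by apply: eq_fsbigr => v; rewrite inE => Vv; rewrite /g piece_trig_sum.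
transitivity (\sum_(v \in setT) g v).
  apply: fsbig_widen => // v [_ Vv]; apply: g0 => n ns; apply/eqP => nv.
  have [v' Vv' [b Bb nE]] := sA ns; apply: Vv.
  by move: nv; rewrite nE valuations_mpow// => /val_inj <-.
apply: fsbig_seq_supp => //.
  rewrite map_inj_uniq ?enum_uniq// => x y /(congr1 val) /= H.
  exact/val_inj/(inj_map val_inj).
move=> v _ vS; apply: g0 => n ns; apply: contraNneq vS => nv.
apply/mapP; exists [tuple Ordinal (sK n ns i) | i < r]; first exact: mem_enum.
apply/val_inj; rewrite /= -nv /valuations -map_comp.
by rewrite -[in LHS](map_tnth_enum ps) -map_comp.
Qed.

End Decomposition.

End Pieces.

(** * The theorem *)

Theorem theorem5p1 (R : realType) (q : R) (hq : 1 < q) :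
  exists2 C : R, 0 < C &
  forall (r : nat) (p : r.-tuple nat)
         (V : set (r.-tuple nat)) (B : r.-tuple nat -> set int) (A : set int)
         (f : R -> R[i]) (fhat : int -> R[i]),
    (forall i : 'I_r, prime (tnth p i)) ->
    uniq p ->
    (forall v, V v -> forall b, B v b ->
       coprimez b (\prod_(i < r) tnth p i)%N%:Z) ->
    A = \bigcup_(v in V) [set (mpow p v)%:Z * b | b in B v] ->
    trig_poly f fhat ->
    (forall n, fhat n != 0 -> A n) ->
    (Lqnorm q f <= (C ^+ r)%:E * Lqnorm q (square_function p V B fhat))%E.
Proof.
have q0 : 0 < q by lra.
have [C C0 [Phi [Gam bel]]] : exists2 C : R, 0 < C &
    exists Phi Gam, bellman (q / 2) C Phi Gam by apply: bellman_exists; lra.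
exists (C `^ q^-1); first exact: powR_gt0.
move=> r ps V B A f fhat psP psU BP AE ft fA.
have [s sU [sE fE]] := trig_poly_trig_sum ft.
have sA : {in s, forall n, exists2 v, V v & exists2 b, B v b & n = (mpow ps v)%:Z * b}.
  move=> n; rewrite sE => /fA; rewrite AE => -[v Vv [b Bb <-]].
  by exists v => //; exists b.
pose K := (\max_(n <- s) `|n|).+1.
(* with an index [i] at hand, coprimality to the primes excludes [n = 0] *)
have sn0K : {in s, forall n i, n != 0 /\ (logn (tnth ps i) `|n| < K)%N}.
  move=> n ns i; have n0 : n != 0.
    have [v Vv [b Bb ->]] := sA n ns.
    have [b0 _] := logn_mpow_mul v i psP psU (BP _ Vv _ Bb).
    rewrite mulf_neq0// -lt0n; apply: prodn_gt0 => j.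
    by rewrite expn_gt0 prime_gt0.
  split=> //; rewrite ltnS (leq_trans (ltnW (ltn_logl _ _)))// ?absz_gt0//.
  exact: (leq_bigmax_seq (F := fun n : int => `|n|%N) _ ns isT).
pose N := (\prod_(i < r) tnth ps i ^ K)%N.
have N0 : (0 < N)%N by apply: prodn_gt0 => j; rewrite expn_gt0 prime_gt0.
have psN i : prime (tnth ps i) /\ (tnth ps i ^ K %| N)%N.
  by split=> //; rewrite /N (bigD1 i)//= dvdn_mulr.
pose Sq u := \sum_(v : r.-tuple 'I_K)
  cmod (trig_sum s fhat (fun n => valuations ps n == map val v) u) ^+ 2.
have Sq0 u : 0 <= Sq u by apply: sumr_ge0 => v _; exact: sqr_ge0.
have cmod0 (z : R[i]) : 0 <= cmod z by case: z => a b; exact: sqrtr_ge0.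
have sqrq (x : R) : 0 <= x -> Num.sqrt x `^ q = x `^ (q / 2).
  by move=> x0; rewrite -powR12_sqrt// -powRrM mulrC.
have fq t : cmod (f t) `^ q = (cmod (trig_sum s fhat xpredT t) ^+ 2) `^ (q / 2).
  by rewrite fE -sqrq ?sqr_ge0// sqrtr_sqr ger0_norm.
have Sqq t : cmod (square_function ps V B fhat t) `^ q = Sq t `^ (q / 2).
  rewrite /square_function (sum_sqr_piece (K := K) psP psU BP sU sE sA); last first.
    by move=> n ns i; have [] := sn0K n ns i.
  by rewrite -/(Sq t) /cmod /= expr0n addr0 sqrtr_sqr ger0_norm ?sqrtr_ge0// sqrq.
rewrite /Lqnorm.
under eq_integral do rewrite fq.
under [in leRHS]eq_integral do rewrite Sqq.
have mSq : measurable_fun setT Sq.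
  by apply: measurable_sum => v; exact: measurable_sqr_cmod_trig_sum.
have pM (g : R -> R) : measurable_fun setT g ->
    measurable_fun setT (fun t => g t `^ (q / 2)).
  exact: measurableT_comp (measurable_powR _).
have mf := measurable_sqr_cmod_trig_sum s fhat xpredT.
have per_f : periodic (fun t => (cmod (trig_sum s fhat xpredT t) ^+ 2) `^ (q / 2)) 1.
  by move=> t; rewrite trig_sum_periodic1.
have per_Sq : periodic (fun t => Sq t `^ (q / 2)) 1.
  by move=> t; rewrite /Sq; under eq_bigr do rewrite trig_sum_periodic1.
have le_int := @ge0_le_integral_avg R N (C ^+ r)
  (fun t => (cmod (trig_sum s fhat xpredT t) ^+ 2) `^ (q / 2))
  (fun t => Sq t `^ (q / 2)) N0 (exprn_ge0 _ (ltW C0)).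
have {}le_int := le_int (pM _ mf) (fun=> powR_ge0 _ _) per_f (pM _ mSq)
  (fun=> powR_ge0 _ _) per_Sq (fun t => square_function_many_primes fhat bel (ltW C0) t N0 psN sn0K).
have int0 (g : R -> R) : (forall t, 0 <= g t) ->
    (0 <= \int[lebesgue_measure]_(t in `[0%R, 1%R]) (g t)%:E)%E.
  by move=> g0; apply: integral_ge0 => t _; rewrite lee_fin.
have iq0 : 0 <= q^-1 by rewrite invr_ge0 ltW.
rewrite (_ : (C `^ q^-1) ^+ r = (C ^+ r) `^ q^-1); last first.
  by rewrite -!powR_mulrn ?powR_ge0 ?(ltW C0)// powRAC.
rewrite -poweR_EFin -poweRM ?lee_fin ?exprn_ge0 ?(ltW C0)//; last first.
  by apply: int0 => t; exact: powR_ge0.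
apply: gt0_ler_poweR => //.
- by rewrite in_itv /= leey int0// => t; exact: powR_ge0.
- rewrite in_itv /= leey andbT mule_ge0 ?lee_fin ?exprn_ge0 ?(ltW C0)// int0// => t.
  exact: powR_ge0.

Qed.
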